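(* Let $k \ge 1$ and let $G$ be a bipartite graph with bipartition $(X, Y)$. If $\beta^k(G, X) \ge 1$, then $G$ contains $k$ pairwise edge-disjoint matchings, each of which covers all vertices in $X$.
   Context: All graphs are finite and simple. For $S\subseteq V(G)$, $\Lambda^k_G(S)$ is the set of vertices of $G$ having at least $k$ neighbors in $S$. For a bipartite graph $G$ with bipartition $(X,Y)$, the weak bipartite $k$-th binding number is $\beta^k(G,X)=\min\{|\Lambda^k_G(S)|/|S| : S\subseteq X,\ |S|\ge k\}$, with $\beta^k(G,X)=0$ if $|X|<k$. *)

(* Defs.v *)
From mathcomp Require Import all_boot all_order all_algebra.

Set Implicit Arguments.
Unset Strict Implicit.
Unset Printing Implicit Defensive.

Import Order.TTheory GRing.Theory Num.Theory.

Record sgraph := SGraph {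
  vertex :> finType;
  adj : rel vertex;
  adj_sym : symmetric adj;
  adj_irrefl : irreflexive adj }.

Section SimpleGraph.

Variable G : sgraph.
Implicit Types (S X Y : {set G}) (M : {set {set G}}) (k : nat).

Definition edges : {set {set G}} :=
  [set [set p.1; p.2] | p : G * G & adj p.1 p.2].

Definition nbrs_in (v : G) S : {set G} := [set u in S | adj v u].

Definition bigLambda k S : {set G} := [set v | k <= #|nbrs_in v S|].

Definition bipartition X Y : Prop :=
  [/\ X :|: Y = [set: G], [disjoint X & Y] &
      forall u v : G, adj u v ->
        (u \in X) && (v \in Y) || (u \in Y) && (v \in X)].

Definition expansion k S : rat := (#|bigLambda k S|%:R / #|S|%:R)%R.

(* When k <= #|X|, the set X itself is admissible, so the [arg min] below is a
   genuine minimizer over the sets S included in X with at least k elements.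
   For k = 0 the empty set would be admissible, with ratio 0 / 0 = 0. *)
Definition weak_binding k X : rat :=
  if #|X| < k then 0%R
  else expansion k
         [arg min_(S < X | (S \subset X) && (k <= #|S|)) expansion k S]%O.

Definition matching M : Prop := M \subset edges /\ trivIset M.

Definition covers M X : Prop := X \subset cover M.

End SimpleGraph.

(* Main.v *)
(** A graph with left degrees [k] and right degrees at most [k] splits into [k]
    matchings covering the left side, so it suffices to find such a subgraph.

    Call a bipartite edge set E feasible for a demand [b] and a capacity [k] if
    every set S of left vertices satisfies
    [\sum_(x in S) b x <= \sum_y min(k, deg_S y)].  The right-hand side is
    submodular in S, so tight sets are closed under intersection; hence in a
    feasible E an edge at any x with more than [b x] edges can be deleted while
    keeping feasibility, and a minimal feasible E has left degrees exactly [b]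
    and right degrees at most [k].  With [b = k] on X, feasibility follows from
    the binding number: for [#|S| >= k] the vertices of [Lambda^k S] alone
    contribute [k * #|S|], and smaller S are handled by noting that every
    vertex of X has at least k neighbours.

    The resulting subgraph of maximum degree [k], with loops added to make all
    row and column sums equal to [k], is a natural-number matrix that
    decomposes into [k] permutation matrices (Birkhoff), each of which
    restricts to a matching covering X.  The case [b = 1], [k = 1] of the first
    step is Hall's theorem, which provides the permutations. *)
Require Import Defs.
From mathcomp Require Import all_boot all_order all_algebra.
From mathcomp Require Import zify.

Set Implicit Arguments.
Unset Strict Implicit.

(** * Subgraphs with prescribed left degrees and bounded right degrees *)

Section DegreeConstrainedSubgraph.

Variables (A B : finType) (k : nat) (b : A -> nat).
Implicit Types (E : {set A * B}) (S T : {set A}) (x : A) (y : B).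

Definition rdeg E x := #|[set y | (x, y) \in E]|.

Definition cdeg E S y := #|[set x in S | (x, y) \in E]|.

Definition capacity E S := \sum_y minn k (cdeg E S y).

Definition feasible E := forall S, \sum_(x in S) b x <= capacity E S.

Definition tight E S := \sum_(x in S) b x == capacity E S.

Lemma rdegE E x : rdeg E x = \sum_y ((x, y) \in E).
Proof. by rewrite /rdeg -sum1dep_card big_mkcond. Qed.

Lemma cdegE E S y : cdeg E S y = \sum_(x in S) ((x, y) \in E).
Proof. by rewrite /cdeg -sum1dep_card big_mkcondr. Qed.

Lemma cdegT E y : cdeg E setT y = \sum_x ((x, y) \in E).
Proof. by rewrite cdegE; apply: eq_bigl => x; rewrite inE. Qed.

Lemma cdegS E S T y : S \subset T -> cdeg E S y <= cdeg E T y.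
Proof.
move=> /subsetP sST; apply/subset_leq_card/subsetP => x.
by rewrite !inE => /andP[/sST-> ->].
Qed.

Lemma cdegUI E S T y :
  cdeg E (S :|: T) y + cdeg E (S :&: T) y = cdeg E S y + cdeg E T y.
Proof.
rewrite /cdeg -[RHS]cardsUI; congr (_ + _); apply: eq_card => x; rewrite !inE.
  by rewrite andb_orl.
by case: (_ \in E); rewrite ?andbT ?andbF.
Qed.

Lemma cdegD1 E S x y : x \in S ->
  cdeg E S y = ((x, y) \in E) + cdeg E (S :\ x) y.
Proof. by move=> xS; rewrite !cdegE (big_setD1 x). Qed.

Lemma cdeg_rem_edge E S x y z :
  cdeg (E :\ (x, y)) S z + [&& z == y, x \in S & (x, y) \in E] = cdeg E S z.
Proof.
rewrite !cdegE; have [xS|xS] /= := boolP (x \in S); last first.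
  rewrite andbF addn0; apply: eq_bigr => u uS; rewrite !inE xpair_eqE.
  by case: eqP uS xS => // -> ->.
rewrite !(big_setD1 x xS) /= addnAC; congr (_ + _).
  by rewrite !inE xpair_eqE eqxx /=; case: eqP => [->|] //=; rewrite addn0.
apply: eq_bigr => u; rewrite !inE xpair_eqE => /andP[/negPf-> _].
by rewrite andFb.
Qed.

(** Holds separately at each [y]: [minn k] is concave, and by [cdegUI] the degrees into the union
    and the intersection have the same sum as those into [S] and [T], but lie further apart. *)
Lemma capacity_submod E S T :
  capacity E (S :|: T) + capacity E (S :&: T) <= capacity E S + capacity E T.
Proof.
rewrite /capacity -!big_split /=; apply: leq_sum => y _.
have := cdegUI E S T y.
have := cdegS E y (subsetIl S T); have := cdegS E y (subsetIr S T).
by lia.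
Qed.

Lemma tightI E S T : feasible E -> tight E S -> tight E T -> tight E (S :&: T).
Proof.
move=> feasE /eqP tS /eqP tT; apply/eqP.
have := capacity_submod E S T.
have := feasE (S :&: T); have := feasE (S :|: T).
have : \sum_(x in S :|: T) b x + \sum_(x in S :&: T) b x =
       \sum_(x in S) b x + \sum_(x in T) b x.
  rewrite !(big_mkcond (fun x => x \in _)) /= -!big_split /=.
  apply: eq_bigr => x _; rewrite !inE.
  by case: (x \in S); case: (x \in T); rewrite /= ?addn0.
by lia.
Qed.

Lemma sum_rdeg E : \sum_x rdeg E x = \sum_y cdeg E setT y.
Proof.
under eq_bigr do rewrite rdegE; rewrite exchange_big /=.
by apply: eq_bigr => y _; rewrite cdegT.
Qed.

Lemma feasible_rdeg E x : feasible E -> b x <= rdeg E x.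
Proof.
move=> /(_ [set x]); rewrite big_set1 => /leq_trans; apply.
rewrite rdegE; apply: leq_sum => y _; rewrite geq_min orbC.
by rewrite cdegE big_set1 leqnn.
Qed.

(** Deleting one edge lowers the capacity of a set by at most one, and only if the set contains [x]
    and [y] is not over-saturated; a set violated after the deletion was therefore tight before. *)
Lemma blocking_tight_set E x y : feasible E -> (x, y) \in E ->
  ~ feasible (E :\ (x, y)) ->
  exists2 S, tight E S & (x \in S) && (cdeg E S y <= k).
Proof.
move=> feasE xyE nfeas.
have [S Sviol] : exists S, capacity (E :\ (x, y)) S < \sum_(x in S) b x.
  have [/existsP//|/existsPn H] :=
    boolP [exists S, capacity (E :\ (x, y)) S < \sum_(x in S) b x].
  by case: nfeas => S; rewrite leqNgt.
have capE : capacity E S = capacity (E :\ (x, y)) S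
                           + ((x \in S) && (cdeg E S y <= k)).
  rewrite /capacity (bigD1 y) //= [in RHS](bigD1 y) //= addnAC; congr (_ + _).
    by have := cdeg_rem_edge E S x y y; rewrite eqxx xyE /= andbT; lia.
  apply: eq_bigr => z /negPf zy; have := cdeg_rem_edge E S x y z.
  by rewrite zy /= addn0 => ->.
have := feasE S; exists S; last by lia.
by apply/eqP; lia.
Qed.

Lemma feasible_rem_edge E x : feasible E -> b x < rdeg E x ->
  exists2 y, (x, y) \in E & feasible (E :\ (x, y)).
Proof.
move=> feasE ltbx.
pose feasb F := [forall S : {set A}, \sum_(u in S) b u <= capacity F S].
have feasP F : reflect (feasible F) (feasb F) by apply: forallP.
have [/existsP[y /andP[xyE /feasP]]|/existsPn nrem] :=
  boolP [exists y, ((x, y) \in E) && feasb (E :\ (x, y))]; first by exists y.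
have block y : (x, y) \in E ->
    exists2 S, tight E S & (x \in S) && (cdeg E S y <= k).
  move=> xyE; apply: blocking_tight_set => // /feasP fE.
  by have := nrem y; rewrite xyE fE.
have [y0] : exists y, y \in [set y | (x, y) \in E].
  by apply/set0Pn; rewrite -card_gt0; apply: leq_ltn_trans ltbx.
rewrite inE => /block[S0 tS0 /andP[xS0 _]].
(* By [tightI], a smallest tight set through [x] lies inside every blocking set, so it blocks all
   edges at [x] at once. *)
case: (arg_minnP (P := fun S => tight E S && (x \in S)) (fun S => #|S|)
  (i0 := S0)) => [|T /andP[tT xT] minT]; first by rewrite tS0.
have Tk y : (x, y) \in E -> cdeg E T y <= k.
  move=> /block[S tS /andP[xS]]; apply: leq_trans; apply: cdegS.
  have /minT leTS : tight E (S :&: T) && (x \in S :&: T).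
    by rewrite tightI // inE xS.
  have /eqP <- : S :&: T == T by rewrite eqEcard subsetIr.
  exact: subsetIl.
(* Removing [x] from [T] lowers the capacity by [rdeg E x] but the demand only by [b x], so [T :\ x]
   would violate feasibility. *)
have capT : capacity E T = rdeg E x + capacity E (T :\ x).
  rewrite rdegE -big_split; apply: eq_bigr => y _ /=.
  have := cdegD1 E y xT; have := Tk y.
  by case: (_ \in E) => [/(_ isT)|_]; lia.
have := feasE (T :\ x); move/eqP: tT; rewrite (big_setD1 x xT) /= capT.
by lia.
Qed.

Theorem degree_constrained_subgraph E : feasible E ->
  exists F : {set A * B},
    [/\ F \subset E, forall x, rdeg F x = b x & forall y, cdeg F setT y <= k].
Proof.
have [n] := ubnP #|E|; elim: n E => // n IHn E ltEn feasE.
have [/existsP[x ltbx]|/existsPn degE] := boolP [exists x, b x < rdeg E x].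
  have [y xyE feasE'] := feasible_rem_edge feasE ltbx.
  have [|F [sFE Fr Fc]] := IHn _ _ feasE'.
    by move: ltEn; rewrite (cardsD1 (x, y) E) xyE.
  by exists F; split=> //; apply: subset_trans sFE (subD1set _ _).
have eqr x : rdeg E x = b x.
  by apply/eqP; rewrite eqn_leq feasible_rdeg // leqNgt degE.
exists E; split=> // y0.
(* The total demand is now the number of edges, so truncation at [k] cannot lose anything at any
   [y]. *)
have := feasE setT; rewrite (eq_bigl xpredT) => [|x]; last by rewrite inE.
under eq_bigr do rewrite -eqr.
rewrite sum_rdeg /capacity (bigD1 y0) //= [X in _ <= X](bigD1 y0) //=.
have : \sum_(y | y != y0) minn k (cdeg E setT y)
         <= \sum_(y | y != y0) cdeg E setT y.
  by apply: leq_sum => y _; rewrite geq_minr.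
by lia.
Qed.

End DegreeConstrainedSubgraph.

(** * Hall's theorem and decomposition into permutations *)

Lemma hall (V : finType) (E : {set V * V}) :
  feasible 1 (fun=> 1) E ->
  exists2 s : V -> V, injective s & forall u, (u, s u) \in E.
Proof.
(* With [k] and [b] equal to 1 the capacity of a set counts its neighbours, and [F] is the graph of
   an injection. *)
move=> /degree_constrained_subgraph[F [/subsetP sFE Fr Fc]].
have sP u : exists v, [set v | (u, v) \in F] == [set v].
  by have /eqP/cards1P[v ->] := Fr u; exists v.
pose s u := xchoose (sP u).
have sF u : (u, s u) \in F.
  by move/eqP/setP/(_ (s u)): (xchooseP (sP u)); rewrite !inE eqxx.
exists s => [u u' eqs|u]; last exact: sFE.
by apply: (card_le1_eqP (Fc (s u))); rewrite !inE ?sF // eqs sF.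
Qed.

Lemma birkhoff_nat (V : finType) k (M : V -> V -> nat) :
  (forall u, \sum_v M u v = k) -> (forall v, \sum_u M u v = k) ->
  exists2 s : 'I_k -> V -> V, forall i, injective (s i) &
    forall u v, M u v = \sum_i (s i u == v).
Proof.
elim: k M => [|k IHk] M Mr Mc.
  exists (fun _ u => u) => [[]//|u v].
  by move/eqP: (Mr u); rewrite big_ord0 sum_nat_eq0 => /forallP/(_ v)/eqP.
pose E := [set p : V * V | 0 < M p.1 p.2].
have [S|s0 inj_s0 s0M] := @hall V E.
  (* Hall's condition for the support, scaled by [k.+1]: the whole weight of the rows in [S] sits in
     the columns adjacent to [S], each of total weight [k.+1]. *)
  rewrite sum1_card -(leq_pmul2l (ltn0Sn k)) mulnC -sum_nat_const.
  under eq_bigr => u _ do rewrite -(Mr u).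
  rewrite exchange_big /= big_distrr; apply: leq_sum => v _ /=.
  have [/eqP|dpos] := posnP (cdeg E S v).
    rewrite cdegE sum_nat_eq0 => /forallP d0; rewrite big1 // => u uS.
    by have := d0 u; rewrite uS inE /=; case: (M u v).
  rewrite (minn_idPl dpos) muln1 -(Mc v) [leqRHS](bigID (fun u => u \in S)) /=.
  exact: leq_addr.
have {}s0M u v : (s0 u == v) <= M u v.
  by case: eqP => // <-; have := s0M u; rewrite inE.
have [g s0K gK] := injF_bij inj_s0.
have [u|v|s inj_s sM] := IHk (fun u v => M u v - (s0 u == v)).
- rewrite sumnB // Mr (bigD1 (s0 u)) //= eqxx big1 ?subn1 // => v.
  by rewrite eq_sym => /negPf->.
- rewrite sumnB // Mc (bigD1 (g v)) //= gK eqxx big1 ?subn1 // => u.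
  by rewrite (can2_eq s0K gK) => /negPf->.
exists (fun i => if unlift ord0 i is Some j then s j else s0) => [i|u v].
  by case: unliftP.
rewrite big_ord_recl unlift_none -(subnKC (s0M u v)) sM.
by congr (_ + _); apply: eq_bigr => i _; rewrite liftK.
Qed.

(** * From the binding number to disjoint injections *)

Section BindingNumber.

Variables (G : sgraph) (X Y : {set G}) (k : nat).
Hypotheses (k_gt0 : 0 < k) (bipXY : bipartition X Y).
Hypothesis bindX : (1 <= weak_binding k X)%R.

Lemma binding_card : k <= #|X|.
Proof. by move: bindX; rewrite /weak_binding; case: ltnP. Qed.

Lemma binding_bigLambda (S : {set G}) :
  S \subset X -> k <= #|S| -> #|S| <= #|bigLambda k S|.
Proof.
move=> sSX kS; move: bindX; rewrite /weak_binding ltnNge binding_card /=.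
case: Order.TotalTheory.arg_minP => [|T _ minT].
  by rewrite subxx; apply: binding_card.
have /minT leTS : (S \subset X) && (k <= #|S|) by rewrite sSX.
move=> /Order.POrderTheory.le_trans/(_ leTS).
rewrite /expansion Num.Theory.ler_pdivlMr ?GRing.mul1r ?Num.Theory.ler_nat //.
by rewrite Num.Theory.ltr0n (leq_trans k_gt0).
Qed.

(** For a [k]-subset [S] of [X] through [x], at least [k] vertices have [k] neighbours in [S]; each
    of them is adjacent to all of [S], hence to [x]. *)
Lemma binding_degree x : x \in X -> k <= #|[set y | adj x y]|.
Proof.
move=> xX.
have [S xS] : exists2 S : {set G}, x \in S & (S \subset X) && (#|S| == k).
  have : 0 < 'C(#|X :\ x|, k.-1).
    by rewrite bin_gt0; have := binding_card; rewrite (cardsD1 x) xX; lia.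
  rewrite -cards_draws card_gt0 => /set0Pn[S]; rewrite inE => /andP[sSX /eqP Sk].
  exists (x |: S); first exact: setU11.
  rewrite subUset sub1set xX (subset_trans sSX (subD1set _ _)) cardsU1 Sk.
  have -> : x \notin S by apply/negP => /(subsetP sSX); rewrite !inE eqxx.
  by rewrite add1n prednK // eqxx.
case/andP=> sSX /eqP Sk.
rewrite -{1}Sk; apply: leq_trans (binding_bigLambda sSX _) _; first by rewrite Sk.
apply/subset_leq_card/subsetP => v; rewrite !inE -Sk => leS.
have /eqP/setP/(_ x) : nbrs_in v S == S.
  by rewrite eqEcard leS andbT; apply/subsetP => u; rewrite inE => /andP[].
by rewrite inE xS /= adj_sym.
Qed.

(** Both sides of the edge set are copies of [G]; the demand vanishes off [X], so only [S :&: X]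
    matters. *)
Lemma binding_feasible :
  feasible k (fun x => k * (x \in X)) [set p : G * G | (p.1 \in X) && adj p.1 p.2].
Proof.
set E := [set _ | _] => S.
have cdegX v : cdeg E S v = #|nbrs_in v (S :&: X)|.
  by apply: eq_card => x; rewrite !inE adj_sym andbA.
rewrite -big_distrr /= -big_mkcondr /= sum1dep_card.
rewrite -/(S :&: X).
have [kS|ltSk] := leqP k #|S :&: X|.
  apply: leq_trans (_ : k * #|bigLambda k (S :&: X)| <= _).
    by rewrite leq_mul2l binding_bigLambda ?subsetIr ?orbT.
  rewrite mulnC -sum_nat_const big_mkcond; apply: leq_sum => v _ /=.
  by rewrite inE -cdegX; case: ifP; lia.
(* With fewer than [k] vertices no truncation occurs, and the capacity counts all edges leaving
   [S :&: X]. *)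
apply: leq_trans (_ : \sum_(x in S :&: X) #|[set y | adj x y]| <= _).
  rewrite mulnC -sum_nat_const; apply: leq_sum => x.
  by rewrite inE => /andP[_]; apply: binding_degree.
under eq_bigr do rewrite -sum1dep_card big_mkcond /=.
rewrite exchange_big; apply: leq_sum => v _ /=.
have -> : \sum_(x in S :&: X) (if adj x v then 1 else 0) = cdeg E S v.
  rewrite cdegX /nbrs_in -big_mkcondr sum1dep_card.
  by apply: eq_card => x; rewrite !inE adj_sym.
rewrite leq_min leqnn andbT cdegX; apply: leq_trans (ltnW ltSk).
by apply/subset_leq_card/subsetP => u; rewrite inE => /andP[].
Qed.

Lemma not_adjX u v : u \in X -> v \in X -> adj u v = false.
Proof.
case: bipXY => _ /pred0P disjXY adjXY uX vX; apply/negP => /adjXY.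
by have := disjXY u; have := disjXY v; rewrite /= uX vX /= => -> ->.
Qed.

Lemma binding_disjoint_injections :
  exists2 s : 'I_k -> G -> G, forall i, injective (s i) &
    forall x, x \in X ->
      (forall i, adj x (s i x)) /\ (forall i j, s i x = s j x -> i = j).
Proof.
have [F [/subsetP sFE Fr Fc]] := degree_constrained_subgraph binding_feasible.
have FP u v : (u, v) \in F -> (u \in X) && adj u v.
  by move=> /sFE; rewrite inE.
have FX u v : v \in X -> (u, v) \in F = false.
  by move=> vX; apply/negP => /FP/andP[uX]; rewrite not_adjX.
(* The degree of [u] in [F] viewed as an undirected graph: the second term vanishes on [X], the
   first off [X]. *)
pose d u := rdeg F u + cdeg F setT u.
have dk u : d u <= k.
  rewrite /d Fr; have [uX|_] := boolP (u \in X); last by rewrite muln0 add0n Fc.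
  by rewrite cdegT big1 ?addn0 ?muln1 // => v _; rewrite FX.
pose M u v := ((u, v) \in F) + ((v, u) \in F) + (u == v) * (k - d u).
have Mr u : \sum_v M u v = k.
  rewrite !big_split /= -rdegE -cdegT (bigD1 u) //= eqxx mul1n big1 ?addn0.
    exact: subnKC (dk u).
  by move=> v; rewrite eq_sym => /negPf->.
have Msym u v : M u v = M v u.
  rewrite /M [((u, v) \in F) + _]addnC eq_sym; congr (_ + _).
  by case: eqP => // ->.
have Mc v : \sum_u M u v = k by rewrite -[RHS](Mr v); apply: eq_bigr.
have [s inj_s sM] := birkhoff_nat Mr Mc.
exists s => // x xX.
(* No loop is added at [x], so row [x] of [M] is the 0/1 row of [F]; a repeated value [s i x] would
   give an entry of at least 2. *)
have dx : d x = k.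
  apply/eqP; rewrite eqn_leq dk /d Fr xX muln1; exact: leq_addr.
have {}sM v : \sum_i (s i x == v) = ((x, v) \in F).
  by rewrite -sM /M (FX v x xX) dx subnn muln0 !addn0.
split=> [i|i j eqs].
  have := sM (s i x); rewrite (bigD1 i) //= eqxx.
  by case: (boolP (_ \in F)) => // /FP/andP[].
apply/eqP/negPn/negP => neq_ij.
have := sM (s i x); rewrite (bigD1 i) //= (bigD1 j) 1?eq_sym //= eqs eqxx.
by case: (_ \in F).
Qed.

End BindingNumber.

(** * Matchings from the injections *)

Unset Implicit Arguments.
Set Strict Implicit.

Theorem theorem1p4 (k : nat) (G : sgraph) (X Y : {set G}) :
  1 <= k ->
  bipartition X Y ->
  (1 <= weak_binding k X)%R ->
  exists M : 'I_k -> {set {set G}},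
    [/\ forall i, matching (M i),
        forall i j, i != j -> [disjoint M i & M j] &
        forall i, covers (M i) X].
Proof.
move=> k_gt0 bipXY bindX.
have [s inj_s sX] := binding_disjoint_injections k_gt0 bipXY bindX.
(* Hence [[set x; s i x]] meets [X] in [x] alone, and the edge determines [x]. *)
have sNX i x : x \in X -> s i x \notin X.
  by move=> xX; apply/negP => /(not_adjX bipXY xX); case: (sX x xX) => ->.
exists (fun i => [set [set x; s i x] | x in X]); split=> [i|i j neq_ij|i].
- split.
    apply/subsetP => _ /imsetP[x xX ->]; apply/imsetP; exists (x, s i x) => //.
    by rewrite inE; case: (sX x xX) => /(_ i).
  apply/trivIsetP => _ _ /imsetP[x xX ->] /imsetP[x' xX' ->] neq_e.
  have neq_x : x != x' by apply: contraNneq neq_e => ->.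
  rewrite -setI_eq0; apply/eqP/setP => v; rewrite !inE.
  apply/negP => /andP[/orP[]/eqP-> /orP[]].
  + exact/negP.
  + by move/eqP=> e; have := sNX i x' xX'; rewrite -e xX.
  + by move/eqP=> e; have := sNX i x xX; rewrite e xX'.
  + by rewrite (inj_eq (inj_s i)); apply/negP.
- rewrite -setI_eq0; apply/eqP/setP => e; rewrite !inE.
  apply/negP => /andP[/imsetP[x xX ->] /imsetP[x' xX' /setP eqe]].
  have /eqP eqx : x == x'.
    have := eqe x; rewrite !inE eqxx /= => /esym/orP[//|/eqP e'].
    by have := sNX j x' xX'; rewrite -e' xX.
  have /eqP eqs : s i x == s j x.
    have := eqe (s i x); rewrite !inE eqxx orbT -eqx => /esym/orP[/eqP e'|//].
    by have := sNX i x xX; rewrite e' xX.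
  by case/eqP: neq_ij; case: (sX x xX) => _; apply.
apply/subsetP => x xX; apply/bigcupP; exists [set x; s i x]; last exact: set21.
exact: imset_f.
Qed.
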